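(* Let $\sigma$ be a partition of the set of all primes, $\tau$ a subgroup functor and $n$ a non-negative integer. The complete lattice $l^{\tau}_{\sigma_n}$ of all $\tau$-closed $n$-multiply $\sigma$-local formations (ordered by inclusion) is algebraic, i.e. each of its elements is a join of compact elements.
   Context: All groups are finite; classes of groups are closed under isomorphism. $\sigma=\{\sigma_i\mid i\in I\}$ is a partition of the set $\mathbb{P}$ of all primes; $\pi(G)$ is the set of primes dividing $|G|$; $\sigma(G)=\{\sigma_i\mid \sigma_i\cap\pi(G)\neq\emptyset\}$ and $\sigma(\mathfrak{X})=\bigcup_{G\in\mathfrak{X}}\sigma(G)$. $\sigma_i'=\mathbb{P}\setminus\sigma_i$; $O_{\sigma_i}(G)$, $O_{\sigma_i'}(G)$ are the largest normal $\sigma_i$-subgroup and $\sigma_i'$-subgroup of $G$; $F_{\{\sigma_i\}}(G)=O_{\sigma_i',\sigma_i}(G)$ is defined by $O_{\sigma_i',\sigma_i}(G)/O_{\sigma_i'}(G)=O_{\sigma_i}(G/O_{\sigma_i'}(G))$. A formation is a class of groups $\mathfrak F$ such that $G\in\mathfrak F$ implies $G/N\in\mathfrak F$, and $G/N,G/R\in\mathfrak F$ implies $G/(N\cap R)\in\mathfrak F$. A formation $\sigma$-function is a function $f:\sigma\to\{\text{formations of groups}\}$ (the value $\emptyset$ is allowed); $LF_\sigma(f)$ is the class of all $G$ such that $G=1$, or $G\ne1$ and $G/F_{\{\sigma_i\}}(G)\in f(\sigma_i)$ for all $\sigma_i\in\sigma(G)$. Every formation is $0$-multiply $\sigma$-local;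 for $n>0$ a formation $\mathfrak F$ is $n$-multiply $\sigma$-local if either $\mathfrak F=(1)$ (the class of identity groups) or $\mathfrak F=LF_\sigma(f)$ where $f(\sigma_i)$ is $(n-1)$-multiply $\sigma$-local for all $\sigma_i\in\sigma(\mathfrak F)$. A subgroup functor $\tau$ assigns to each group $G$ a set $\tau(G)$ of subgroups of $G$ with $G\in\tau(G)$ such that for every epimorphism $\varphi:A\to B$ and all $H\in\tau(A)$, $T\in\tau(B)$ we have $H^{\varphi}\in\tau(B)$ and $T^{\varphi^{-1}}\in\tau(A)$. A class $\mathfrak F$ is $\tau$-closed if $\tau(G)\subseteq\mathfrak F$ for all $G\in\mathfrak F$. In $l^{\tau}_{\sigma_n}$ the meet of a family is its intersection, and the join of $\{\mathfrak F_j\mid j\in J\}$ is $l^{\tau}_{\sigma_n}\mathrm{form}(\bigcup_{j\in J}\mathfrak F_j)$, where $l^{\tau}_{\sigma_n}\mathrm{form}(\mathfrak X)$ denotes the intersection of all $\tau$-closed $n$-multiply $\sigma$-local formations containing $\mathfrak X$. *)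

(* Defs.v *)
From mathcomp Require Import all_boot all_fingroup all_solvable.
From Stdlib Require Import FunctionalExtensionality PropExtensionality.

Set Implicit Arguments.
Unset Strict Implicit.
Unset Printing Implicit Defensive.

Import GroupScope.

Definition prime_partition (I : Type) (sigma : I -> nat_pred) : Prop :=
  [/\ forall i p, p \in sigma i -> prime p,
      forall i, exists p, p \in sigma i,
      forall i j p, p \in sigma i -> p \in sigma j -> i = j
    & forall p, prime p -> exists i, p \in sigma i].

Definition group_class := forall gT : finGroupType, {group gT} -> Prop.

Definition class_sub (F1 F2 : group_class) : Prop :=
  forall (gT : finGroupType) (G : {group gT}), F1 gT G -> F2 gT G.

Definition class_bigcap (X : group_class -> Prop) : group_class :=
  fun gT G => forall F, X F -> F gT G.

Definition class_bigcup (X : group_class -> Prop) : group_class :=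
  fun gT G => exists2 F, X F & F gT G.

Definition identity_class : group_class := fun gT G => G :=: 1.

Definition iso_closed (F : group_class) : Prop :=
  forall (gT rT : finGroupType) (G : {group gT}) (H : {group rT}),
    G \isog H -> F gT G -> F rT H.

(* The empty class is a formation. *)
Definition formation (F : group_class) : Prop :=
  [/\ iso_closed F,
      forall (gT : finGroupType) (G N : {group gT}),
        N <| G -> F gT G -> F _ (G / N)%G
    & forall (gT : finGroupType) (G N R : {group gT}),
        N <| G -> R <| G -> F _ (G / N)%G -> F _ (G / R)%G ->
        F _ (G / (N :&: R))%G].

(* Since the blocks of a partition are nonempty and disjoint, the block
   sigma i is identified with its index i; in particular sigma(G) and sigma(F)
   are sets of indices, and functions on sigma are functions on I. *)
Definition sigma_group (I : Type) (sigma : I -> nat_pred)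
    (gT : finGroupType) (G : {group gT}) (i : I) : Prop :=
  exists2 p, p \in \pi(G) & p \in sigma i.

Definition sigma_class (I : Type) (sigma : I -> nat_pred)
    (F : group_class) (i : I) : Prop :=
  exists (gT : finGroupType) (G : {group gT}),
    F gT G /\ sigma_group sigma G i.

Definition LF (I : Type) (sigma : I -> nat_pred) (f : I -> group_class) :
    group_class :=
  fun gT G => G :=: 1 \/
    (G :<>: 1 /\ forall i, sigma_group sigma G i ->
       f i _ (G / 'O_{(sigma i)^', sigma i}(G))%G).

Fixpoint multiply_local (I : Type) (sigma : I -> nat_pred) (n : nat)
    (F : group_class) : Prop :=
  match n with
  | 0 => formation F
  | m.+1 => formation F /\
      (F = identity_class \/
       exists f : I -> group_class,
         [/\ forall i, formation (f i),
             F = LF sigma f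
           & forall i, sigma_class sigma F i -> multiply_local sigma m (f i)])
  end.

Definition group_functor :=
  forall gT : finGroupType, {group gT} -> {set {group gT}}.

Definition subgroup_functor (tau : group_functor) : Prop :=
  [/\ forall (gT : finGroupType) (G H : {group gT}),
        H \in tau gT G -> H \subset G,
      forall (gT : finGroupType) (G : {group gT}), G \in tau gT G
    & forall (aT rT : finGroupType) (A : {group aT}) (B : {group rT})
        (phi : {morphism A >-> rT}), phi @* A = B ->
        (forall H : {group aT}, H \in tau aT A -> (phi @* H)%G \in tau rT B) /\
        (forall T : {group rT}, T \in tau rT B -> (phi @*^-1 T)%G \in tau aT A)].

Definition tau_closed (tau : group_functor) (F : group_class) : Prop :=
  forall (gT : finGroupType) (G H : {group gT}),
    F gT G -> H \in tau gT G -> F gT H.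

Definition tau_local (I : Type) (sigma : I -> nat_pred) (tau : group_functor)
    (n : nat) (F : group_class) : Prop :=
  tau_closed tau F /\ multiply_local sigma n F.

Definition tau_local_form (I : Type) (sigma : I -> nat_pred)
    (tau : group_functor) (n : nat) (X : group_class) : group_class :=
  class_bigcap (fun F => tau_local sigma tau n F /\ class_sub X F).

Definition tau_local_join (I : Type) (sigma : I -> nat_pred)
    (tau : group_functor) (n : nat) (X : group_class -> Prop) : group_class :=
  tau_local_form sigma tau n (class_bigcup X).

(* mathcomp.classical's set and finite_set cannot be used here: they live in a
   universe too small to contain group_class. *)
Definition finite_subfamily (X0 X : group_class -> Prop) : Prop :=
  (forall F, X0 F -> X F) /\
  exists (k : nat) (E : 'I_k -> group_class),
    forall F, X0 F <-> exists j, F = E j.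

Definition compact_element (I : Type) (sigma : I -> nat_pred)
    (tau : group_functor) (n : nat) (C : group_class) : Prop :=
  tau_local sigma tau n C /\
  forall X : group_class -> Prop, (forall F, X F -> tau_local sigma tau n F) ->
    class_sub C (tau_local_join sigma tau n X) ->
    exists2 X0 : group_class -> Prop, finite_subfamily X0 X
      & class_sub C (tau_local_join sigma tau n X0).

Definition algebraic_tau_local (I : Type) (sigma : I -> nat_pred)
    (tau : group_functor) (n : nat) : Prop :=
  forall F, tau_local sigma tau n F ->
    exists2 X : group_class -> Prop,
      forall C, X C -> compact_element sigma tau n C
      & F = tau_local_join sigma tau n X.

(* Completeness of the lattice: the intersection of any family of members (for
   the empty family, the class of all groups) is again a member, so that
   class_bigcap and tau_local_join are the greatest lower bound and the least
   upper bound with respect to inclusion. *)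

Lemma group_class_ext (F1 F2 : group_class) :
  (forall (gT : finGroupType) (G : {group gT}), F1 gT G <-> F2 gT G) -> F1 = F2.
Proof.
move=> eqF; apply: functional_extensionality_dep => gT.
by apply: functional_extensionality => G; apply: propositional_extensionality.
Qed.

Lemma formation_bigcap (X : group_class -> Prop) :
  (forall F, X F -> formation F) -> formation (class_bigcap X).
Proof.
move=> hX; split.
- move=> gT rT G H isoGH FG F XF; case: (hX F XF) => h _ _.
  exact: h isoGH (FG F XF).
- move=> gT G N nNG FG F XF; case: (hX F XF) => _ h _.
  exact: h nNG (FG F XF).
- move=> gT G N R nN nR FN FR F XF; case: (hX F XF) => _ _ h.
  exact: h nN nR (FN F XF) (FR F XF).
Qed.

Lemma sigma_group_neq1 (I : Type) (sigma : I -> nat_pred)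
    (gT : finGroupType) (G : {group gT}) :
  prime_partition sigma -> G :<>: 1 -> exists i, sigma_group sigma G i.
Proof.
case=> _ _ _ cover ntG; have: G :!=: 1 by apply/eqP.
rewrite -cardG_gt1 => G_gt1.
have [i hi] := cover _ (pdiv_prime G_gt1).
by exists i; exists (pdiv #|G|); rewrite ?pi_pdiv.
Qed.

Lemma sigma_class_identity (I : Type) (sigma : I -> nat_pred) (i : I) :
  ~ sigma_class sigma identity_class i.
Proof. by case=> gT [G [G1 [p]]]; rewrite G1 /= cards1. Qed.

Lemma multiply_localS (I : Type) (sigma : I -> nat_pred) n F :
  prime_partition sigma ->
  multiply_local sigma n.+1 F <->
  formation F /\ exists f : I -> group_class,
    [/\ forall i, formation (f i), F = LF sigma f
      & forall i, sigma_class sigma F i -> multiply_local sigma n (f i)].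
Proof.
move=> part; split=> -[formF hF]; last by split=> //; right.
case: hF => [F1|]; split=> //; exists (fun _ _ _ => False); split.
- by move=> i; split.
- rewrite F1; apply: group_class_ext => gT G; split=> [G1|]; first by left.
  by case=> // -[ntG hG]; have [i Gi] := sigma_group_neq1 part ntG; case: (hG i Gi).
- by move=> i; rewrite F1 => Fi; case: (sigma_class_identity Fi).
Qed.

Lemma multiply_local_bigcap (I : Type) (sigma : I -> nat_pred) n
    (X : group_class -> Prop) :
  prime_partition sigma -> (forall F, X F -> multiply_local sigma n F) ->
  multiply_local sigma n (class_bigcap X).
Proof.
move=> part; elim: n X => [|n IHn] X hX; first exact: formation_bigcap.
pose sat F f := [/\ X F, forall i, formation (f i), F = LF sigma f
  & forall i, sigma_class sigma F i -> multiply_local sigma n (f i)].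
pose Y i C := exists F f, sat F f /\ C = f i.
apply/(multiply_localS _ _ part); split.
  by apply: formation_bigcap => F /hX[].
exists (fun i => class_bigcap (Y i)); split.
- by move=> i; apply: formation_bigcap => _ [F [f [[_ ff _ _] ->]]].
- apply: group_class_ext => gT G; split=> [FG|].
    case: (eqVneq (G : {set gT}) 1) => [G1|/eqP ntG]; [by left | right].
    split=> // i Gi _ [F [f [[XF _ eqF _] ->]]].
    by have := FG F XF; rewrite eqF => -[//|[_]]; apply.
  case=> [G1 F XF | [ntG hG] F XF].
    have /(multiply_localS _ _ part)[_ [f [_ -> _]]] := hX F XF.
    by left.
  have /(multiply_localS _ _ part)[_ [f [ff eqF hf]]] := hX F XF.
  rewrite eqF; right; split=> // i Gi.
  by apply: (hG i Gi (f i)); exists F, f.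
- move=> i [gT [G [FG Gi]]]; apply: IHn => _ [F [f [[XF _ _ hf] ->]]].
  by apply: hf; exists gT, G; split=> //; apply: FG.
Qed.

Lemma tau_local_bigcap (I : Type) (sigma : I -> nat_pred)
    (tau : group_functor) n (X : group_class -> Prop) :
  prime_partition sigma -> (forall F, X F -> tau_local sigma tau n F) ->
  tau_local sigma tau n (class_bigcap X).
Proof.
move=> part hX; split; last by apply: multiply_local_bigcap => // F /hX[].
move=> gT G H FG tauH F XF; have [clF _] := hX F XF.
exact: clF (FG F XF) tauH.
Qed.

Lemma tau_local_join_lub (I : Type) (sigma : I -> nat_pred)
    (tau : group_functor) n (X : group_class -> Prop) :
  prime_partition sigma ->
  [/\ tau_local sigma tau n (tau_local_join sigma tau n X),
      forall F, X F -> class_sub F (tau_local_join sigma tau n X)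
    & forall M, tau_local sigma tau n M -> (forall F, X F -> class_sub F M) ->
        class_sub (tau_local_join sigma tau n X) M].
Proof.
move=> part; split.
- by apply: tau_local_bigcap => // F [].
- by move=> F XF gT G FG M [_ subM]; apply: subM; exists F.
- move=> M locM ubM gT G; apply; split=> // rT H [F XF].
  exact: ubM.
Qed.

(* Main.v *)
Require Import Defs.
From mathcomp Require Import all_boot all_fingroup all_solvable.

(** Every element [F] of the lattice is the join of the one-generated elements
    it contains, namely of the least tau-closed n-multiply sigma-local
    formations containing a given group [G] of [F]; so it is enough that
    one-generated elements are compact.  The joins of the finite subfamilies of
    a family [X] form an upward directed family.  If the union [U] of that
    directed family is again an element of the lattice, then [U] is the join of
    [X], so a group [G] lying in the join of [X] already lies in the join of
    some finite subfamily, and with [G] the whole element generated by [G].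

    Everything thus rests on [multiply_local_directed_union]: a directed union
    of n-multiply sigma-local formations is n-multiply sigma-local.  The proof
    is by induction on [n].  A member [F] of the directed family may be defined
    by many sigma-functions, and functions chosen at random for the various
    members would not be comparable.  So each [F] is given its least one, with
    values [least_value], which by [multiply_localS_least] still defines [F] and
    which increases with [F].  The union of these functions has
    (n-1)-multiply sigma-local values by induction, and it defines the union of
    the family: membership of a group [G] in a sigma-local formation involves
    one condition for each block meeting [\pi(G)], and these are finitely many,
    so by directedness they are witnessed by one single member. *)

Set Implicit Arguments.
Unset Strict Implicit.
Unset Printing Implicit Defensive.

Import GroupScope.

Definition directed (Y : group_class -> Prop) : Prop :=
  (exists F, Y F) /\
  forall F1 F2, Y F1 -> Y F2 -> exists F, [/\ Y F, class_sub F1 F & class_sub F2 F].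

Lemma directed_seq (Y : group_class -> Prop) (T : eqType) (s : seq T)
    (P : T -> group_class -> Prop) :
  directed Y ->
  (forall x F1 F2, Y F1 -> Y F2 -> class_sub F1 F2 -> P x F1 -> P x F2) ->
  (forall x, x \in s -> exists2 F, Y F & P x F) ->
  exists2 F, Y F & forall x, x \in s -> P x F.
Proof.
move=> [[F0 YF0] dirY] monP; elim: s => [|x s IHs] Ps; first by exists F0.
have [y ys|F1 YF1 PF1] := IHs; first by apply: Ps; rewrite inE ys orbT.
have [F2 YF2 PF2] := Ps x (mem_head x s).
have [F [YF sub1 sub2]] := dirY _ _ YF1 YF2.
exists F => // y; rewrite inE => /orP[/eqP-> | ys].
  exact: monP sub2 PF2.
exact: monP sub1 (PF1 y ys).
Qed.

Lemma multiply_local_formation (I : Type) (sigma : I -> nat_pred) n F :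
  multiply_local sigma n F -> formation F.
Proof. by case: n => [|n] // []. Qed.

(** A failure of a closure property involves at most two groups of the union,
    and by directedness these two lie in a common member.  The family may be empty,
    as happens for the values of a sigma-function outside the blocks of the
    formation it defines; the union is then the empty formation. *)
Lemma formation_directed_union (Y : group_class -> Prop) :
  (forall F1 F2, Y F1 -> Y F2 ->
     exists F, [/\ Y F, class_sub F1 F & class_sub F2 F]) ->
  (forall F, Y F -> formation F) -> formation (class_bigcup Y).
Proof.
move=> dirY formY; split.
- move=> gT rT G H isoGH [F YF FG]; exists F => //.
  by have [isoF _ _] := formY F YF; apply: isoF FG.
- move=> gT G N nNG [F YF FG]; exists F => //.
  by have [_ quoF _] := formY F YF; apply: quoF FG.
- move=> gT G N R nNG nRG [F1 YF1 FN] [F2 YF2 FR].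
  have [F [YF sub1 sub2]] := dirY _ _ YF1 YF2; exists F => //.
  by have [_ _ subF] := formY F YF; apply: subF => //; [apply: sub1 | apply: sub2].
Qed.

(** * The least sigma-function of a sigma-local formation *)

(** This is the value at [i] of the least sigma-function defining [F]; it is
    meant for the blocks [i] of [F] only.  At any other [i] the least function
    takes the empty value, whereas the present class contains the groups of
    order 1 as soon as [m > 0]. *)
Definition least_value (I : Type) (sigma : I -> nat_pred) (m : nat)
    (F : group_class) (i : I) : group_class :=
  class_bigcap (fun C => multiply_local sigma m C /\
    forall (gT : finGroupType) (G : {group gT}), F gT G ->
      sigma_group sigma G i -> C _ (G / 'O_{(sigma i)^', sigma i}(G))%G).

Lemma least_value_sub (I : Type) (sigma : I -> nat_pred) m F1 F2 i :
  class_sub F1 F2 ->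
  class_sub (least_value sigma m F1 i) (least_value sigma m F2 i).
Proof.
move=> subF gT G GL C [locC genC]; apply: GL; split=> // rT H /subF.
exact: genC.
Qed.

Lemma sigma_class_sub (I : Type) (sigma : I -> nat_pred) F1 F2 i :
  class_sub F1 F2 -> sigma_class sigma F1 i -> sigma_class sigma F2 i.
Proof. by move=> subF [gT [G [/subF FG Gi]]]; exists gT, G. Qed.

(** Any function [f] defining [F] is bounded below by the least values at the
    blocks of [F], because [f i] is one of the classes intersected there. *)
Lemma multiply_localS_least (I : Type) (sigma : I -> nat_pred) m F
    (gT : finGroupType) (G : {group gT}) :
  prime_partition sigma -> multiply_local sigma m.+1 F ->
  F gT G <-> G :=: 1 \/ (G :<>: 1 /\ forall i, sigma_group sigma G i ->
    sigma_class sigma F i /\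
    least_value sigma m F i (G / 'O_{(sigma i)^', sigma i}(G))%G).
Proof.
move=> part /(multiply_localS _ _ part)[_ [f [_ defF locf]]]; split=> [FG|].
  case: (eqVneq (G : {set gT}) 1) => [G1 | /eqP ntG]; [by left | right].
  split=> // i Gi; split; first by exists gT, G.
  by move=> C [_ genC]; apply: genC.
move=> memG; rewrite defF.
case: memG => [G1 | [ntG Gf]]; [by left | right; split=> // i Gi].
have [Fi] := Gf i Gi; apply; split; first exact: locf.
move=> rT H; rewrite {1}defF => -[H1 [p] | [_ Hf]]; last exact: Hf.
by rewrite H1 /= cards1.
Qed.

(** * Directed unions of lattice elements *)

Lemma multiply_local_directed_union (I : Type) (sigma : I -> nat_pred) n
    (Y : group_class -> Prop) :
  prime_partition sigma -> directed Y ->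
  (forall F, Y F -> multiply_local sigma n F) ->
  multiply_local sigma n (class_bigcup Y).
Proof.
move=> part; elim: n Y => [|n IHn] Y dirY locY.
  by apply: formation_directed_union locY; case: dirY.
(* Only members having i among their blocks contribute to the value at i, so
   that this value is empty outside the blocks of the union. *)
pose Z i C := exists F,
  [/\ Y F, sigma_class sigma F i & C = least_value sigma n F i].
have locZ i C : Z i C -> multiply_local sigma n C.
  by case=> F [_ _ ->]; apply: multiply_local_bigcap => // D [].
have dirZ i C1 C2 : Z i C1 -> Z i C2 ->
    exists C, [/\ Z i C, class_sub C1 C & class_sub C2 C].
  move=> [F1 [YF1 F1i ->]] [F2 [YF2 F2i ->]].
  have [F [YF sub1 sub2]] := dirY.2 _ _ YF1 YF2.
  exists (least_value sigma n F i); split; try exact: least_value_sub.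
  by exists F; split=> //; apply: sigma_class_sub F1i.
have formZ i : formation (class_bigcup (Z i)).
  apply: formation_directed_union (dirZ i) _ => C /locZ.
  exact: multiply_local_formation.
apply/(multiply_localS _ _ part); split.
  by apply: formation_directed_union dirY.2 _ => F /locY[].
exists (fun i => class_bigcup (Z i)); split=> //; last first.
  move=> i [gT [G [[F YF FG] Gi]]]; apply: IHn (locZ i).
  split; last exact: dirZ.
  by exists (least_value sigma n F i), F; split=> //; exists gT, G.
apply: group_class_ext => gT G; split=> [[F YF] | ].
  case/(multiply_localS_least _ part (locY F YF)) => [G1 | [ntG Gl]].
    by left.
  right; split=> // i /Gl[Fi GlF].
  by exists (least_value sigma n F i) => //; exists F.
case=> [G1 | [ntG GZ]].
  have [F YF] := dirY.1; exists F => //.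
  by apply/(multiply_localS_least _ part (locY F YF)); left.
(* The blocks of G are indexed by an arbitrary type; they are reached through
   the finite list of the primes dividing the order of G. *)
pose P p F := forall i, p \in sigma i -> sigma_class sigma F i /\
  least_value sigma n F i (G / 'O_{(sigma i)^', sigma i}(G))%G.
have [|p Gp|F YF FP] := directed_seq (s := primes #|G|) (P := P) dirY.
- move=> p F1 F2 _ _ sub12 P1 i /P1[F1i GF1].
  by split; [apply: sigma_class_sub F1i | apply: least_value_sub GF1].
- have [_ _ disj cover] := part.
  have [i pi] : exists i, p \in sigma i.
    by apply: cover; move: Gp; rewrite mem_primes => /andP[].
  have /GZ[_ [F [YF Fi ->]] GF] : sigma_group sigma G i by exists p.
  by exists F => // j pj; rewrite -(disj i j p pi pj).
exists F => //; apply/(multiply_localS_least _ part (locY F YF)); right.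
by split=> // i [p Gp]; apply: FP.
Qed.

Lemma tau_local_directed_union (I : Type) (sigma : I -> nat_pred)
    (tau : group_functor) n (Y : group_class -> Prop) :
  prime_partition sigma -> directed Y ->
  (forall F, Y F -> tau_local sigma tau n F) ->
  tau_local sigma tau n (class_bigcup Y).
Proof.
move=> part dirY locY; split.
  move=> gT G H [F YF FG] tauH; exists F => //.
  by have [clF _] := locY F YF; apply: clF FG tauH.
by apply: multiply_local_directed_union => // F /locY[].
Qed.

(** * Compactness of one-generated elements *)

Lemma tau_local_join_mono (I : Type) (sigma : I -> nat_pred)
    (tau : group_functor) n (X1 X2 : group_class -> Prop) :
  (forall F, X1 F -> X2 F) ->
  class_sub (tau_local_join sigma tau n X1) (tau_local_join sigma tau n X2).
Proof.
move=> sub12 gT G GX M [locM subM]; apply: GX; split=> // rT H [F X1F FH].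
by apply: subM; exists F => //; apply: sub12.
Qed.

Lemma finite_subfamily0 (X : group_class -> Prop) :
  finite_subfamily (fun _ => False) X.
Proof.
split=> //; exists 0%N, (fun _ => identity_class) => F.
by split=> // -[[]].
Qed.

Lemma finite_subfamily1 (X : group_class -> Prop) F :
  X F -> finite_subfamily (eq F) X.
Proof.
move=> XF; split=> [_ <- // |]; exists 1%N, (fun _ => F) => F1.
by split=> [<-|[_ ->]] //; exists ord0.
Qed.

Lemma finite_subfamilyU (X0 X1 X : group_class -> Prop) :
  finite_subfamily X0 X -> finite_subfamily X1 X ->
  finite_subfamily (fun F => X0 F \/ X1 F) X.
Proof.
move=> [sub0 [k0 [E0 def0]]] [sub1 [k1 [E1 def1]]].
split=> [F [/sub0|/sub1] //|].
exists (k0 + k1)%N.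
exists (fun j => match split j with inl a => E0 a | inr b => E1 b end).
move=> F; split=> [[/def0[a ->] | /def1[b ->]] | [j ->]].
- by exists (unsplit (inl a)); rewrite unsplitK.
- by exists (unsplit (inr b)); rewrite unsplitK.
- case: (split j) => [a|b]; first by left; apply/def0; exists a.
  by right; apply/def1; exists b.
Qed.

Lemma directed_finite_joins (I : Type) (sigma : I -> nat_pred)
    (tau : group_functor) n (X : group_class -> Prop) :
  directed (fun J => exists2 X0, finite_subfamily X0 X
                     & J = tau_local_join sigma tau n X0).
Proof.
split.
  exists (tau_local_join sigma tau n (fun _ => False)), (fun _ => False) => //.
  exact: finite_subfamily0.
move=> _ _ [X0 fin0 ->] [X1 fin1 ->].
exists (tau_local_join sigma tau n (fun F => X0 F \/ X1 F)); split.
- by exists (fun F => X0 F \/ X1 F) => //; apply: finite_subfamilyU.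
- by apply: tau_local_join_mono => F; left.
- by apply: tau_local_join_mono => F; right.
Qed.

(** The lattice join is finitary because the union of the finite joins is
    already an element of the lattice, hence contains the whole join. *)
Lemma tau_local_join_finitary (I : Type) (sigma : I -> nat_pred)
    (tau : group_functor) n (X : group_class -> Prop)
    (gT : finGroupType) (G : {group gT}) :
  prime_partition sigma -> tau_local_join sigma tau n X G ->
  exists2 X0, finite_subfamily X0 X & tau_local_join sigma tau n X0 G.
Proof.
move=> part joinG.
have [|_ [X0 finX0 ->] X0G] := joinG (class_bigcup (fun J =>
  exists2 X0, finite_subfamily X0 X & J = tau_local_join sigma tau n X0)).
- split.
    apply: tau_local_directed_union => //; first exact: directed_finite_joins.
    move=> _ [X0 _ ->].
    by have [] := tau_local_join_lub tau n X0 part.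
  move=> rT H [F XF FH].
  exists (tau_local_join sigma tau n (eq F)).
    by exists (eq F) => //; apply: finite_subfamily1.
  by have [_ ub _] := tau_local_join_lub tau n (eq F) part; apply: ub FH.
- by exists X0.
Qed.

Definition isog_class (gT : finGroupType) (G : {group gT}) : group_class :=
  fun rT H => G \isog H.

Lemma tau_local_form_isog_sub (I : Type) (sigma : I -> nat_pred)
    (tau : group_functor) n (gT : finGroupType) (G : {group gT}) F :
  tau_local sigma tau n F -> F gT G ->
  class_sub (tau_local_form sigma tau n (isog_class G)) F.
Proof.
move=> locF FG rT H; apply; split=> // sT K isoGK.
by have [isoF _ _] := multiply_local_formation locF.2; apply: isoF FG.
Qed.

Lemma tau_local_form_isog_id (I : Type) (sigma : I -> nat_pred)
    (tau : group_functor) n (gT : finGroupType) (G : {group gT}) :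
  tau_local_form sigma tau n (isog_class G) G.
Proof. by move=> F [_]; apply; apply: isog_refl. Qed.

Lemma compact_one_generated (I : Type) (sigma : I -> nat_pred)
    (tau : group_functor) n (gT : finGroupType) (G : {group gT}) :
  prime_partition sigma ->
  compact_element sigma tau n (tau_local_form sigma tau n (isog_class G)).
Proof.
move=> part; split; first by apply: tau_local_bigcap => // F [].
move=> X _ subX.
have joinG : tau_local_join sigma tau n X G.
  by apply: subX; apply: tau_local_form_isog_id.
have [X0 finX0 X0G] := tau_local_join_finitary part joinG.
exists X0 => //; apply: tau_local_form_isog_sub X0G.
by have [] := tau_local_join_lub tau n X0 part.
Qed.

Theorem theorem3p6 (I : Type) (sigma : I -> nat_pred) (tau : group_functor)
    (n : nat) (hsigma : prime_partition sigma) (htau : subgroup_functor tau) :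
  algebraic_tau_local sigma tau n.
Proof.
move=> F locF.
pose X C := exists (gT : finGroupType) (G : {group gT}),
  F gT G /\ C = tau_local_form sigma tau n (isog_class G).
exists X => [_ [gT [G [_ ->]]] | ]; first exact: compact_one_generated.
have [_ ubX lubX] := tau_local_join_lub tau n X hsigma.
apply: group_class_ext => gT G; split=> [FG|].
  apply: (ubX (tau_local_form sigma tau n (isog_class G))).
    by exists gT, G.
  exact: tau_local_form_isog_id.
by apply: lubX => // _ [rT [H [FH ->]]]; apply: tau_local_form_isog_sub.
Qed.
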